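(* Suppose there is a $\sigma$-finite measure $\nu$ on $(\Omega,\mathcal{T})$ such that $a\ll\nu$ for all $a\in\Lambda$. Let $\pi\in\Lambda$. If for $m^\pi$-almost every $x\in\mathcal{X}$ one has $p_\theta(x)>0$ for $\nu$-almost every $\theta$, then for $m^\pi$-almost every $x$ the map $a\mapsto\Pi_x^a$ is injective on $\Lambda$.
   Context: $(\Omega,\mathcal{T})$ is a standard Borel parameter space; $\{P_\theta:\theta\in\Omega\}$ is a family of probability measures on a measurable space $(\mathcal{X},\mathcal{A})$ dominated by a $\sigma$-finite measure $\lambda$, with densities $p_\theta=dP_\theta/d\lambda$. $\Lambda$ is a set of probability measures on $(\Omega,\mathcal{T})$ (priors). For a prior $\pi$, the prior predictive $m^\pi$ is the measure on $\mathcal{X}$ with $\frac{dm^\pi}{d\lambda}(x)=\int_\Omega p_\theta(x)\,d\pi(\theta)$, and $\Pi_x^\pi$ is the Bayes posterior on $\Omega$ given $X=x$, i.e. the probability measure with density proportional to $\theta\mapsto p_\theta(x)$ with respect to $\pi$; Bayes posteriors are assumed to exist for $m^\pi$-almost all $x$ and to be measurable in $x$. For the $x$ at which injectivity is asserted, the posteriors $\Pi_x^a$, $a\in\Lambda$, are assumed to exist. *)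

(* Defs.v *)
From HB Require Import structures.
From mathcomp Require Import all_boot all_order all_algebra.
From mathcomp Require Import all_classical all_reals all_analysis.
From mathcomp Require Import measurable_realfun.

Set Implicit Arguments.
Unset Strict Implicit.
Unset Printing Implicit Defensive.

Import Order.TTheory GRing.Theory Num.Theory.

Local Open Scope classical_set_scope.
Local Open Scope ring_scope.

(* [Omega] is isomorphic, as a measurable space, to a Polish space with its
   Borel sets.  A Hausdorff pseudometric space is a metric space. *)
Definition standard_borel (R : realType) (d : measure_display)
    (Omega : measurableType d) : Prop :=
  exists (M : completePseudoMetricType R) (f : Omega -> M),
    [/\ hausdorff_space M,
        exists2 D : set M, countable D & dense D,
        bijective f
      & forall A : set Omega, measurable A <-> <<s @open M >> (f @` A)].

(* [p theta] is a version of the density of [P theta] w.r.t. [lambda]. *)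
Definition is_density_family (R : realType) (dX : measure_display)
    (Omega : Type) (X : measurableType dX)
    (lambda : {measure set X -> \bar R})
    (P : Omega -> probability X R) (p : Omega -> X -> R) : Prop :=
  forall theta,
    [/\ forall x, 0 <= p theta x,
        measurable_fun [set: X] (p theta)
      & forall A, measurable A ->
          P theta A = (\int[lambda]_(x in A) (p theta x)%:E)%E].

Section bayes.
Variables (R : realType) (dO dX : measure_display).
Variables (Omega : measurableType dO) (X : measurableType dX).
Variables (lambda : {measure set X -> \bar R}) (p : Omega -> X -> R).
Variable a : probability Omega R.

Definition predictive_density (x : X) : \bar R :=
  (\int[a]_theta (p theta x)%:E)%E.

(* A measure as soon as [predictive_density] is a measurable function. *)
Definition prior_predictive (A : set X) : \bar R :=
  (\int[lambda]_(x in A) predictive_density x)%E.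

(* [c] is necessarily the inverse of [predictive_density x], which is
   therefore positive and finite as soon as a posterior exists at [x]. *)
Definition is_posterior (x : X) (Q : {measure set Omega -> \bar R}) : Prop :=
  Q [set: Omega] = 1%E /\
  exists2 c : R, 0 < c &
    forall B, measurable B ->
      Q B = (\int[a]_(theta in B) (c * p theta x)%:E)%E.

End bayes.

(* The library's measures are functions on all subsets, with unspecified values
   on the non-measurable ones, so Leibniz equality of measures is too fine. *)
Definition same_measure (R : realType) (d : measure_display)
    (T : measurableType d) (m1 m2 : set T -> \bar R) : Prop :=
  forall A, measurable A -> m1 A = m2 A.

Definition injective_on_measures (R : realType) (d : measure_display)
    (T : measurableType d) (L : set (probability T R))
    (F : probability T R -> {measure set T -> \bar R}) : Prop :=
  forall a b, L a -> L b -> same_measure (F a) (F b) -> same_measure a b.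

(* Main.v *)
Require Import Defs.
From HB Require Import structures.
From mathcomp Require Import all_boot all_order all_algebra.
From mathcomp Require Import all_classical all_reals all_analysis.
From mathcomp Require Import measurable_realfun.
Import Order.TTheory GRing.Theory Num.Theory.
Local Open Scope classical_set_scope.
Local Open Scope ring_scope.

(** Bayes' rule can be inverted where the likelihood is positive.  Fix an
    observation [x] and a prior [a] with posterior [Q], so that
    [dQ = c * p_theta(x) da] for some constant [c > 0].  If [p_theta(x) > 0] for
    [a]-almost every [theta], then [da = (c * p_theta(x))^-1 dQ], and [c] is
    determined by [Q] because [a] has mass [1].  Thus [a] is a function of its
    posterior at [x] ([prior_from_posterior]), and two priors with the same
    posterior coincide.

    For almost every [x] the likelihood is positive [nu]-almost everywhere, hence
    [a]-almost everywhere for all the priors [a `<< nu] at once: the exceptional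
    set of [x] does not depend on [a], which matters because [Lambda] may be
    uncountable. *)

Lemma measurable_fun_invr (R : realType) (d : measure_display)
    (T : measurableType d) (g : T -> R) :
  measurable_fun setT g -> (forall t, 0 <= g t) ->
  measurable_fun setT (fun t => (g t)^-1).
Proof.
(* Both the inverse and the power with exponent -1 send 0 to 0. *)
move=> mg g0; under eq_fun do rewrite -powR_inv1//.
exact: measurableT_comp (measurable_powR (-1)) mg.
Qed.

(** A density that is positive almost everywhere can be inverted: change
    variables through the Radon-Nikodym derivative of [Q], which is almost
    everywhere equal to [g], in the integral of [g^-1]. *)
Lemma integral_inv_density (R : realType) (d : measure_display)
    (T : measurableType d) (mu : {sigma_finite_measure set T -> \bar R})
    (Q : {finite_measure set T -> \bar R}) (g : T -> R) (B : set T) :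
  measurable_fun setT g -> (forall t, 0 <= g t) ->
  (forall A, measurable A -> Q A = \int[mu]_(t in A) (g t)%:E)%E ->
  {ae mu, forall t, 0 < g t} -> measurable B ->
  mu B = (\int[Q]_(t in B) (g t)^-1%:E)%E.
Proof.
move=> mg g0 Qg gpos mB.
have Qmu : Q `<< mu.
  apply/null_content_dominatesP => A mA muA0.
  by rewrite Qg//; apply: null_set_integral => //;
     apply/measurable_EFinP; exact: measurable_funTS.
have ig : mu.-integrable setT (EFin \o g).
  apply/integrableP; split; first exact/measurable_EFinP.
  under eq_integral do rewrite /= ger0_norm//.
  by rewrite -Qg//; apply: fin_num_fun_lty; exact: fin_num_measure.
pose h := Radon_Nikodym_SigmaFinite.f Q mu.
have ih : mu.-integrable setT h by exact: Radon_Nikodym_SigmaFinite.f_integrable.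
have hg : ae_eq mu setT h (EFin \o g).
  apply: integral_ae_eq => //; first exact: (measurable_int _ ig).
  by move=> E _ mE; rewrite -Qg// -Radon_Nikodym_SigmaFinite.f_integral.
have mV : measurable_fun setT (fun t => (g t)^-1).
  exact: measurable_fun_invr.
rewrite -(@Radon_Nikodym_SigmaFinite.change_of_variables _ _ _ _ _ Qmu)//; last 2 first.
- by move=> t; rewrite lee_fin invr_ge0.
- by apply/measurable_EFinP; exact: measurable_funTS.
rewrite -[LHS]mul1e -integral_cst//.
apply: ge0_ae_eq_integral => //.
- apply: emeasurable_funM; first by apply/measurable_EFinP; exact: measurable_funTS.
  by apply: measurable_funTS; exact: (measurable_int _ ih).
- move=> t _; rewrite mule_ge0 ?lee_fin ?invr_ge0//.
  exact: Radon_Nikodym_SigmaFinite.f_ge0.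
apply: filterS2 hg gpos => t /(_ I) hgt gt0 _ /=.
by rewrite -/h hgt /= -EFinM mulVf// gt_eqF.
Qed.

(** The normalising factor is explicit: integrating [dQ = c * p_theta(x) da]
    against [p_theta(x)^-1] gives [c] times the mass of [a], so the integral over
    the whole space is [c] itself.  The right-hand side mentions the prior only
    through [Q]. *)
Lemma prior_from_posterior (R : realType) (dO dX : measure_display)
    (Omega : measurableType dO) (X : measurableType dX) (p : Omega -> X -> R)
    (a : probability Omega R) (x : X) (Q : {measure set Omega -> \bar R})
    (B : set Omega) :
  measurable_fun setT (p ^~ x) -> (forall theta, 0 <= p theta x) ->
  {ae a, forall theta, 0 < p theta x} -> is_posterior p a x Q ->
  measurable B ->
  a B = ((fine (\int[Q]_theta (p theta x)^-1%:E))^-1%:E *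
         \int[Q]_(theta in B) (p theta x)^-1%:E)%E.
Proof.
move=> mp p0 ppos [Q1 [c c0 Qc]] mB.
have Qfin : fin_num_fun Q.
  by apply: lty_fin_num_fun; rewrite Q1 ltry.
pose Qf : {finite_measure set Omega -> \bar R} :=
  HB.pack (Measure.sort Q) (Measure_isFinite.Axioms_ _ _ _ Qfin).
have mV : measurable_fun setT (fun t => (p t x)^-1).
  exact: measurable_fun_invr.
have aQ A : measurable A ->
    a A = (c^-1%:E * \int[Q]_(theta in A) (p theta x)^-1%:E)%E.
  move=> mA; rewrite -ge0_integralZl_EFin//; last 3 first.
  - by move=> t _; rewrite lee_fin invr_ge0.
  - by apply/measurable_EFinP; exact: measurable_funTS.
  - by rewrite invr_ge0 ltW.
  under eq_integral do rewrite -EFinM -invfM.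
  apply: (@integral_inv_density _ _ _ a Qf) => //.
  - by apply: measurable_funM.
  - by move=> t; rewrite mulr_ge0// ltW.
  - by apply: filterS ppos => t; exact: mulr_gt0.
have IT : (\int[Q]_theta (p theta x)^-1%:E = c%:E)%E.
  have := aQ setT measurableT; rewrite probability_setT => /(congr1 (mule c%:E)).
  by rewrite mule1 muleA -EFinM divff ?gt_eqF// mul1e => ->.
by rewrite IT aQ.
Qed.

(** The set function with density [f] is a measure, hence its almost everywhere
    filter is closed under intersection. *)
Lemma ae_density_and (R : realType) (d : measure_display)
    (T : measurableType d) (mu : {measure set T -> \bar R}) (f : T -> \bar R)
    (P1 P2 : T -> Prop) :
  measurable_fun setT f -> (forall t, 0 <= f t)%E ->
  {ae (fun A => \int[mu]_(t in A) f t)%E, forall t, P1 t} ->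
  {ae (fun A => \int[mu]_(t in A) f t)%E, forall t, P2 t} ->
  {ae (fun A => \int[mu]_(t in A) f t)%E, forall t, P1 t /\ P2 t}.
Proof.
move=> mf f0 [A [mA A0 PA]] [B [mB B0 PB]]; exists (A `|` B); split.
- exact: measurableU.
- have -> : A `|` B = A `|` (B `\` A).
    by apply/seteqP; split => t; have [|] := pselect (A t) => /= At; tauto.
  rewrite ge0_integral_setU//; last 3 first.
  + exact: measurableD.
  + exact: measurable_funTS.
  + by rewrite disj_set2E setDIK.
  rewrite A0 add0e; apply/eqP; rewrite eq_le integral_ge0// andbT -B0.
  apply: ge0_subset_integral => //; first exact: measurableD.
  exact: measurable_funTS.
- move=> t /= /not_andP[nP|nP]; [left; exact: PA|right; exact: PB].
Qed.

Theorem lemma4p1 (R : realType) (dO dX : measure_display)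
    (Omega : measurableType dO) (X : measurableType dX)
    (Omega_borel : standard_borel R Omega)
    (lambda : {sigma_finite_measure set X -> \bar R})
    (P : Omega -> probability X R) (p : Omega -> X -> R)
    (p_density : is_density_family lambda P p)
    (p_meas : forall x, measurable_fun [set: Omega] (p ^~ x))
    (Lambda : set (probability Omega R))
    (m_meas : forall a, Lambda a ->
       measurable_fun [set: X] (predictive_density p a))
    (Post : probability Omega R -> R.-pker X ~> Omega)
    (Post_posterior : forall a, Lambda a ->
       {ae prior_predictive lambda p a,
          forall x, is_posterior p a x (Post a x)})
    (nu : {sigma_finite_measure set Omega -> \bar R})
    (Lambda_nu : forall a, Lambda a -> a `<< nu)
    (prior : probability Omega R) (Lambda_prior : Lambda prior)
    (Post_exist : {ae prior_predictive lambda p prior,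
       forall x, forall a, Lambda a -> is_posterior p a x (Post a x)})
    (p_pos : {ae prior_predictive lambda p prior,
       forall x, {ae nu, forall theta, 0 < p theta x}}) :
  {ae prior_predictive lambda p prior,
     forall x, injective_on_measures Lambda (fun a => Post a x)}.
Proof.
have p0 theta x : 0 <= p theta x by have [] := p_density theta.
have post_pos : {ae prior_predictive lambda p prior, forall x,
    (forall a, Lambda a -> is_posterior p a x (Post a x)) /\
    {ae nu, forall theta, 0 < p theta x}}.
  apply: ae_density_and => //; first exact: m_meas.
  by move=> x; apply: integral_ge0 => theta _; rewrite lee_fin.
have [N [mN N0 subN]] := post_pos; exists N; split => //.
apply: subset_trans subN; apply: subsetC => x [/= post_x pos_x] a b La Lb Qab B mB.
have pos_ae a' : Lambda a' -> {ae a', forall theta, 0 < p theta x}.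
  have [M [mM M0 subM]] := pos_x => La'; exists M; split => //.
  by move/null_content_dominatesP : (Lambda_nu _ La'); exact.
have eqI A : measurable A -> (\int[Post a x]_(theta in A) (p theta x)^-1%:E =
    \int[Post b x]_(theta in A) (p theta x)^-1%:E)%E.
  by move=> mA; apply: eq_measure_integral => C mC _; exact: Qab.
have recover a' : Lambda a' ->
    a' B = ((fine (\int[Post a' x]_theta (p theta x)^-1%:E))^-1%:E *
            \int[Post a' x]_(theta in B) (p theta x)^-1%:E)%E.
  by move=> La'; apply: prior_from_posterior => //; [exact: pos_ae|exact: post_x].
by rewrite !recover// !eqI.
Qed.
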